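(* Let $s=(s_1,s_2)\in\mathbb R^2$ with $s_1\ne0$ and $s_2\ne0$, and define the multiplicative Legendre transform $\mathcal{ML}(\phi_s)(z)=\big(\phi_s(\mathrm{Inv}_s^{-1}(z))\big)^{-1}$ for $z\in\mathcal{SH}(r)^*\setminus\Sigma^*$ (well defined since $\mathrm{Inv}_s:\mathcal{SH}(r)\setminus\Sigma\to\mathcal{SH}(r)^*\setminus\Sigma^*$ is bijective). Then $\mathcal{ML}(\phi_s)$ equals $\psi_s(z)=|Q_2(z)|^{s_1-(r-1)s_2}\,|Q_1(z)|^{s_2}$ up to a constant multiple: for each $\rho^*(G)$-orbit $O\subset\mathcal{SH}(r)^*\setminus\Sigma^*$ (i.e. each nonempty set of the form $\{z:\varepsilon_1Q_1(z)>0,\ \varepsilon_2Q_2(z)>0\}$, $\varepsilon_i\in\{\pm1\}$) there is a constant $c_O>0$ with $\mathcal{ML}(\phi_s)=c_O\,\psi_s$ on $O$.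
   Context: Fix an integer $r\ge 2$. For $\ell=1,\dots,r+1$ let $Y_\ell\in\mathrm{Mat}(r,\mathbb R)$ have $(i,j)$-entry $\delta_{i+j,\ell+1}$. Let $\mathcal{SH}(r)=\mathrm{span}_{\mathbb R}(Y_1,\dots,Y_{r+1})$, the space of sub-Hankel matrices: $y=\sum_\ell y_\ell Y_\ell$ is the $r\times r$ matrix whose $(i,j)$-entry is $y_{i+j-1}$ if $i+j\le r+2$ and $0$ otherwise. For $k=0,\dots,r-1$ let $T_k$ be the $r\times r$ matrix with $(i,j)$-entry $(r-k-i+1)\delta_{j,i+k}$. Put $H_1=\frac1rT_0-\frac12I_r$, $H_2=I_r-\frac1rT_0=\mathrm{diag}(0,\frac1r,\dots,\frac{r-1}r)$. Let $\mathfrak g=\mathrm{span}(H_1,H_2,T_1,\dots,T_{r-1})$ and $G\subset GL(r,\mathbb R)$ the connected Lie subgroup with Lie algebra $\mathfrak g$; $\rho(g)y=g\,y\,{}^tg$. Let $P_1(y)=\det y$, $P_2(y)=y_{r+1}$, $\Sigma=\{y:P_1(y)P_2(y)=0\}$. Let $\mathcal{SH}(r)^*$ be the dual space with dual basis $Y_1^*,\dots,Y_{r+1}^*$, $z=\sum_\ell z_\ell Y_\ell^*$, pairing $\langle\cdot,\cdot\rangle$; $\langle y,\rho^*(g)z\rangle=\langle\rho(g)^{-1}y,z\rangle$, and $\langle y,d\rho^*(T)z\rangle=-\langle Ty+y\,{}^tT,z\rangle$ for $T\in\mathfrak g$. Let $Q_2(z)=z_1$. Let $\mathfrak g'=\mathrm{span}(H_2,T_1,\dots,T_{r-1})$,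 $W=\mathrm{span}(Y_2^*,\dots,Y_{r+1}^* )$ (one has $d\rho^*(T)z\in W$ for $T\in\mathfrak g'$), $R(z):\mathfrak g'\to W$, $R(z)T=d\rho^*(T)z$, and $Q_1(z)=\frac{(-1)^{r+1}2^{\ell_2(r)}}{r!}\det R(z)$, determinant with respect to the ordered bases $(T_{r-1},\dots,T_1,rH_2)$ and $(-Y_2^*,\dots,-Y_{r+1}^* )$, $\ell_2(r)=\sum_{k\ge1}\lfloor r/2^k\rfloor$. Let $\Sigma^*=\{z:Q_1(z)Q_2(z)=0\}$. For $s=(s_1,s_2)\in\mathbb R^2$ and $y\in\mathcal{SH}(r)\setminus\Sigma$ put $\phi_s(y)=|P_1(y)|^{s_1}|P_2(y)|^{s_2-(r-1)s_1}$ and define $\mathrm{Inv}_s(y)\in\mathcal{SH}(r)^*$ by $\langle v,\mathrm{Inv}_s(y)\rangle=\frac{d}{dt}\big|_{t=0}\log\phi_s(y+tv)$ for all $v\in\mathcal{SH}(r)$. *)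

(* Defs.v *)
From Stdlib Require Import Reals Arith.
Open Scope R_scope.

Fixpoint sum1 (n : nat) (f : nat -> R) : R :=
  match n with
  | O => 0
  | S m => sum1 m f + f (S m)
  end.

(* Matrices: entries (i,j), 1-indexed; only indices 1..r are meaningful. *)
Definition Mat := nat -> nat -> R.

Definition mmul (r : nat) (A B : Mat) : Mat :=
  fun i j => sum1 r (fun k => A i k * B k j).
Definition mtr (A : Mat) : Mat := fun i j => A j i.
Definition madd (A B : Mat) : Mat := fun i j => A i j + B i j.
Definition mscal (a : R) (A : Mat) : Mat := fun i j => a * A i j.

Definition minor1 (A : Mat) (j : nat) : Mat :=
  fun i k => A (S i) (if Nat.ltb k j then k else S k).

Fixpoint det (n : nat) (A : Mat) : R :=
  match n with
  | O => 1
  | S m => sum1 (S m) (fun j => (-1) ^ (j + 1) * A 1%nat j * det m (minor1 A j))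
  end.

Definition Ymat (l : nat) : Mat :=
  fun i j => if Nat.eqb (i + j) (l + 1) then 1 else 0.

(* An element y = sum_l y_l Y_l of SH(r) is given by its coordinates y 1 .. y (r+1);
   likewise z = sum_l z_l Y_l^* in SH(r)^* by z 1 .. z (r+1). *)
Definition shmat (r : nat) (y : nat -> R) : Mat :=
  fun i j => sum1 (r + 1) (fun l => y l * Ymat l i j).

(* Coordinates of a sub-Hankel matrix A = sum_l a_l Y_l:
   a_l = A_{l,1} for l <= r and a_{r+1} = A_{r,2}. *)
Definition shcoord (r : nat) (A : Mat) (l : nat) : R :=
  if Nat.leb l r then A l 1%nat else A r 2%nat.

Definition pair (r : nat) (y z : nat -> R) : R := sum1 (r + 1) (fun l => y l * z l).

Definition mpair (r : nat) (A : Mat) (z : nat -> R) : R :=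
  pair r (shcoord r A) z.

Definition P1 (r : nat) (y : nat -> R) : R := det r (shmat r y).
Definition P2 (r : nat) (y : nat -> R) : R := y (r + 1)%nat.
Definition inSigma (r : nat) (y : nat -> R) : Prop := P1 r y * P2 r y = 0.

Definition phi (r : nat) (s1 s2 : R) (y : nat -> R) : R :=
  Rpower (Rabs (P1 r y)) s1 * Rpower (Rabs (P2 r y)) (s2 - (INR r - 1) * s1).

Definition IsInv (r : nat) (s1 s2 : R) (y z : nat -> R) : Prop :=
  forall v : nat -> R,
    derivable_pt_lim (fun t => ln (phi r s1 s2 (fun l => y l + t * v l))) 0 (pair r v z).

Definition Tmat (r k : nat) : Mat :=
  fun i j => if Nat.eqb j (i + k) then INR r - INR k - INR i + 1 else 0.
Definition Imat : Mat := fun i j => if Nat.eqb i j then 1 else 0.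
Definition H2mat (r : nat) : Mat :=
  fun i j => Imat i j - Tmat r 0 i j / INR r.

(* Ordered basis (T_{r-1}, ..., T_1, r H_2) of g', indexed j = 1..r. *)
Definition gbasis (r j : nat) : Mat :=
  if Nat.ltb j r then Tmat r (r - j) else mscal (INR r) (H2mat r).

(* Matrix of R(z) : g' -> W w.r.t. (T_{r-1},...,T_1,rH_2) and (-Y_2^*,...,-Y_{r+1}^* ).
   Column j is the coordinate vector of d rho^*(T) z, T = j-th basis vector; its
   coefficient on -Y_{i+1}^* is -<Y_{i+1}, d rho^*(T) z> = <T Y_{i+1} + Y_{i+1} tT, z>. *)
Definition Rmat (r : nat) (z : nat -> R) : Mat :=
  fun i j =>
    mpair r (madd (mmul r (gbasis r j) (Ymat (S i)))
                  (mmul r (Ymat (S i)) (mtr (gbasis r j)))) z.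

(* l_2(r) = sum_{k>=1} floor(r/2^k); terms vanish for k > r. *)
Fixpoint l2_aux (r k : nat) : nat :=
  match k with O => O | S k' => l2_aux r k' + Nat.div r (2 ^ S k') end.
Definition l2 (r : nat) : nat := l2_aux r r.

Definition Q1 (r : nat) (z : nat -> R) : R :=
  (-1) ^ (r + 1) * 2 ^ (l2 r) / INR (fact r) * det r (Rmat r z).
Definition Q2 (z : nat -> R) : R := z 1%nat.

Definition psi (r : nat) (s1 s2 : R) (z : nat -> R) : R :=
  Rpower (Rabs (Q2 z)) (s1 - (INR r - 1) * s2) * Rpower (Rabs (Q1 r z)) s2.

(* Main.v *)
Require Import Defs.
From Stdlib Require Import Reals Arith Lra Lia FunctionalExtensionality.
From mathcomp Require all_boot all_fingroup all_algebra Rstruct zify.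
Open Scope R_scope.

(** Put [a_k = y_(r+1-k)] and let [b = 1/a] as power series. Reversing its rows makes a sub-Hankel
    matrix a minor of the triangular Toeplitz matrix of [a], so Cramer's rule gives
    [P1 y = +- a_0^(r+1) b_r], hence [log phi_s = s1 log |b_r| + (2 s1 + s2) log |a_0|]. Since
    [d b = - b^2 d a], [z = Inv_s(y)] means [z_(j+1) = - s1 (b^2)_j / b_r] for [j < r] and
    [z_(r+1) = - s1 (b^2)_r / b_r + (2 s1 + s2) b_0]. With [beta] the power series square root of
    [sum_j (z_(j+1) / z_1) x^j], this system has the unique solution [b_0 = 2 z_1 beta_r / s2],
    [b_j = b_0 beta_j] for [0 < j < r], [b_r = - s1 b_0^2 / z_1]. On the dual side, a column
    operation makes the matrix of [R(z)] triangular and yields [Q1 z = K z_1^r beta_r] for a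
    nonzero constant [K]. Substituting both, [1 / phi_s(y)] is a constant times [psi_s(z)]. *)

(** * Convolution of sequences and two determinant evaluations *)

Definition conv (f g : nat -> R) (n : nat) : R :=
  sum_f_R0 (fun k => f k * g (n - k)%nat) n.

Module DetTheory.
Import all_boot all_fingroup all_algebra Rstruct zify.
Import GRing.Theory.
Local Open Scope ring_scope.
Set Implicit Arguments.
Unset Strict Implicit.

Lemma sum_f_R0_big (f : nat -> R) n : sum_f_R0 f n = \sum_(i < n.+1) f i.
Proof. by elim: n => [|n IH]; rewrite big_ord_recr /= ?big_ord0 ?add0r // IH. Qed.

Lemma sum1_big n (f : nat -> R) : sum1 n f = \sum_(i < n) f i.+1.
Proof. by elim: n => [|n IH]; rewrite ?big_ord0 // big_ord_recr /= IH. Qed.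

(** Coefficient [n] of a product sees only coefficients up to [n], so truncating to polynomials
    loses nothing. This carries the ring laws of polynomials over to [conv]. *)
Lemma convE (f g : nat -> R) n N : (n < N)%N ->
  conv f g n = ((\poly_(i < N) f i) * (\poly_(i < N) g i))`_n.
Proof.
move=> ltnN; rewrite coefM /conv sum_f_R0_big; apply: eq_bigr => i _.
by rewrite !coef_poly (leq_ltn_trans _ ltnN) ?leq_ord // (leq_ltn_trans _ ltnN) ?leq_subr.
Qed.

Lemma conv_comm (f g : nat -> R) : conv f g = conv g f.
Proof. by apply: functional_extensionality => n; rewrite !(convE _ _ (ltnSn n)) mulrC. Qed.

Lemma conv_assoc (f g h : nat -> R) : conv f (conv g h) = conv (conv f g) h.
Proof.
apply: functional_extensionality => n.
have coefK (u v : nat -> R) i : (i < n.+1)%N ->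
    (\poly_(j < n.+1) conv u v j)`_i = ((\poly_(j < n.+1) u j) * (\poly_(j < n.+1) v j))`_i.
  by move=> lti; rewrite coef_poly lti (convE _ _ lti).
rewrite !(convE _ _ (ltnSn n)); set F := poly _ f; set H := poly _ h.
transitivity ((F * ((\poly_(j < n.+1) g j) * H))`_n).
  by rewrite !coefM; apply: eq_bigr => i _; rewrite coefK // ltnS leq_subr.
by rewrite mulrA !(coefM _ H); apply: eq_bigr => i _; rewrite coefK.
Qed.

Lemma det_big n (A : Mat) : Defs.det n A = \det (\matrix_(i < n, j < n) A i.+1 j.+1).
Proof.
elim: n A => [|n IH] A; first by rewrite det_mx00.
rewrite (expand_det_row _ ord0) [LHS]/Defs.det -/Defs.det sum1_big.
apply: eq_bigr => j _; rewrite IH /cofactor mxE add0n mulrA; congr (_ * _).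
  rewrite -[Rmult]/(@GRing.mul R) mulrC; congr (_ * _).
  by rewrite -[IZR (-1)]/(- 1 : R) RpowE plusE addn1 !exprS mulrA mulrNN !mul1r.
congr (\det _); apply/matrixP => i k; rewrite !mxE /minor1; congr (A _ _).
rewrite /= /bump; case: Nat.ltb_spec => ?; case: leqP => ?; lia.
Qed.

(** The sign is chosen before [A], which keeps the constants below uniform in the matrix. *)
Lemma det_reindex_rows n (s : 'I_n -> 'I_n) : injective s ->
  exists2 e : R, e * e = 1 & forall A : 'M[R]_n, \det A = e * \det (\matrix_(i, j) A (s i) j).
Proof.
move=> injs; exists ((-1) ^+ perm injs); first by rewrite -expr2 sqrr_sign.
move=> A; have -> : \matrix_(i, j) A (s i) j = row_perm (perm injs) A.
  by apply/matrixP => i j; rewrite !mxE permE.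
by rewrite row_permE det_mulmx det_perm signrMK.
Qed.

(** Let $T$ be the lower triangular Toeplitz matrix of $a$, of size $r+1$. Deleting row 0 and column
    $r$ leaves [A] with its rows reversed. The inverse of $T$ is the Toeplitz matrix of $b$, so the
    adjugate of $T$ is $a_0^{r+1}$ times that matrix; its corner entry gives the formula up to
    sign. *)
Lemma det_hankel r : exists2 e : R, e * e = 1 &
  forall (a b : nat -> R) (A : Mat),
    conv a b 0%N = 1 -> (forall n, (0 < n)%coq_nat -> (n <= r)%coq_nat -> conv a b n = 0) ->
    (forall i j, (0 < i)%coq_nat -> (0 < j)%coq_nat -> (i + j <= r.+2)%coq_nat ->
       A i j = a (r.+2 - (i + j))%N) ->
    (forall i j, (0 < i)%coq_nat -> (i <= r)%coq_nat -> (0 < j)%coq_nat -> (j <= r)%coq_nat ->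
       (r.+2 < i + j)%coq_nat ->
       A i j = 0) ->
    Defs.det r A = e * (pow (a 0%N) r.+1 * b r).
Proof.
have [e ee detE] := det_reindex_rows (@rev_ord_inj r).
exists ((-1) ^+ r * e); first by rewrite mulrACA ee mulr1 -expr2 sqrr_sign.
move=> a b A ab0 abn Ale Agt.
pose T (f : nat -> R) := \matrix_(i < r.+1, j < r.+1) (if (j <= i)%N then f (i - j)%N else 0).
have TM : T a *m T b = 1%:M.
  apply/matrixP => i j; rewrite !mxE.
  have [leji|ltij] := leqP j i; last first.
    rewrite big1 => [|k _]; first by case: eqP ltij => // ->; rewrite ltnn.
    rewrite !mxE; have [leki|] := leqP k i; last by rewrite mul0r.
    by rewrite leqNgt (leq_ltn_trans leki ltij) /= mulr0.
  (* Only the terms with $j \le k \le i$ survive; shifting $k$ by $j$ leaves a convolution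
     coefficient. *)
  transitivity (conv a b (i - j)).
    transitivity (\sum_(j <= k < i.+1) b (k - j)%N * a (i - k)%N).
      rewrite (big_nat_widen _ _ r.+1) // big_geq_mkord [RHS]big_mkcond.
      apply: eq_bigr => k _; rewrite !mxE /= ltnS.
      by case: (leqP k i); case: (leqP j k); rewrite ?(mulr0, mul0r) //= mulrC.
    rewrite -{1}(add0n (val j)) big_addn subSn // big_mkord conv_comm /conv sum_f_R0_big.
    by apply: eq_bigr => k _; rewrite addnK addnC subnDA.
  case: (eqVneq i j) => [->|neij]; first by rewrite subnn ab0.
  have neij' : (i <> j :> nat) by move=> eij; case/eqP: neij; apply: ord_inj.
  by rewrite abn //; have := ltn_ord i; lia.
have detT : \det (T a) = a 0%N ^+ r.+1.
  rewrite det_trig; last first.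
    by apply/is_trig_mxP => i j ltij; rewrite !mxE leqNgt ltij.
  rewrite (eq_bigr (fun=> a 0%N)) => [|i _]; last by rewrite mxE leqnn subnn.
  by rewrite prodr_const card_ord.
have adjT : \adj (T a) = (a 0%N ^+ r.+1) *: T b.
  by rewrite -detT -[LHS]mulmx1 -TM mulmxA mul_adj_mx mul_scalar_mx.
(* The adjugate transposes: its entry in the last row and first column is the cofactor at row 0 and
   column $r$. The sign $(-1)^r$ of that cofactor cancels the one in the witness. *)
rewrite RpowE; have /= := congr1 (fun M : 'M_r.+1 => M ord_max ord0) adjT.
rewrite !mxE /= subn0 => <-; rewrite /cofactor /= add0n.
rewrite mulrACA -expr2 sqrr_sign mul1r det_big detE.
congr (_ * \det _); apply/matrixP => i j; rewrite !mxE /= /bump.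
have := ltn_ord i; have := ltn_ord j => ltj lti.
have -> : ((r <= j) + j)%N = j by lia.
case: ifP => leji; last by apply: Agt; lia.
by rewrite Ale; [congr a; lia | lia ..].
Qed.

(** Adding the combination [x] of the first [n] columns to the last column leaves only [w] there.
    Reversing the first [n] columns then gives a lower triangular matrix with diagonal $nu, \dots,
    u, w$, so [K] is $\pm n!$. *)
Lemma det_hessenberg n : exists2 K : R, K <> 0 &
  forall (u w : R) (x : nat -> R) (A : Mat),
    (forall i j, (0 < i)%coq_nat -> (0 < j)%coq_nat -> (i + j <= n)%coq_nat -> A i j = 0) ->
    (forall j, (0 < j)%coq_nat -> (j <= n)%coq_nat -> A (n.+1 - j)%N j = INR j * u) ->
    (forall i, (0 < i)%coq_nat -> (i <= n)%coq_nat -> sum1 n (fun j => A i j * x j) + A i n.+1 = 0) ->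
    sum1 n (fun j => A n.+1 j * x j) + A n.+1 n.+1 = w ->
    Defs.det n.+1 A = K * (pow u n * w).
Proof.
pose s (j : 'I_n.+1) : 'I_n.+1 := if (j < n)%N then inord (n.-1 - j) else j.
have sE (j : 'I_n.+1) : s j = (if (j < n)%N then n.-1 - j else j)%N :> nat.
  by rewrite /s; case: ifP => // ltjn; rewrite inordK //; lia.
have injs : injective s.
  move=> i j /(congr1 (@nat_of_ord _)); rewrite !sE => eij; apply/val_inj.
  by have := ltn_ord i; have := ltn_ord j; move: eij; case: ifP; case: ifP => /=; lia.
have [e ee detE] := det_reindex_rows injs.
exists (e * \prod_(i < n) INR (n - i)).
  apply/eqP; rewrite mulf_neq0 //.
    by apply: contraTneq (oner_neq0 R) => e0; rewrite -ee e0 mul0r eqxx.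
  by apply/prodf_neq0 => i _; apply/eqP; apply: not_0_INR; have := ltn_ord i; lia.
move=> u w x A A0 Ad Al Ar; rewrite det_big RpowE.
set M := \matrix_(i, j) _.
(* Right multiplication by this unit upper triangular matrix is the column operation. *)
pose U : 'M[R]_n.+1 :=
  \matrix_(i, j) (if j == ord_max then if i == ord_max then 1 else x i.+1 else (i == j)%:R).
have detU : \det U = 1.
  rewrite -det_tr det_trig; last first.
    apply/is_trig_mxP => i j ltij; rewrite !mxE.
    have -> : (i == ord_max) = false by apply/eqP => E; move: ltij; rewrite E /=; have := ltn_ord j; lia.
    by case: eqP => // E; move: ltij; rewrite E ltnn.
  by rewrite big1 // => i _; rewrite !mxE eqxx; case: eqP.
have ME (i : 'I_n.+1) (j : 'I_n.+1) : (M *m U) i j =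
    if j == ord_max then sum1 n (fun k => A i.+1 k * x k) + A i.+1 n.+1 else A i.+1 j.+1.
  rewrite mxE; have [->|jn] := eqVneq j ord_max.
    rewrite big_ord_recr /= !mxE !eqxx mulr1 sum1_big; congr (_ + _).
    apply: eq_bigr => k _; rewrite !mxE eqxx /=.
    case: eqP => // /(congr1 (@nat_of_ord _)) /=; have := ltn_ord k; lia.
  rewrite (bigD1 j) //= !mxE (negbTE jn) eqxx mulr1 big1 ?addr0 // => k kj.
  by rewrite !mxE (negbTE jn) (negbTE kj) mulr0.
(* Columns are to be permuted, hence the transpositions around [detE]. *)
have -> : \det M = e * \det (\matrix_(i, j) (M *m U)^T (s i) j)^T.
  by rewrite det_tr -detE det_tr det_mulmx detU mulr1.
rewrite det_trig; last first.
  apply/is_trig_mxP => i j ltij. rewrite mxE mxE mxE ME.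
  have := ltn_ord j => ltj.
  have [/(congr1 (@nat_of_ord _)) /=|] := eqVneq (s j) ord_max; rewrite sE; case: ltnP => ltjn sj.
  - lia.
  - by rewrite Al //; lia.
  - by rewrite A0 //; lia.
  - by case/eqP: sj; apply: ord_inj; rewrite sE /=; case: ifP; lia.
rewrite -mulrA; congr (_ * _); rewrite big_ord_recr /=.
rewrite [RHS]mulrA.
congr (_ * _); last first.
  rewrite mxE mxE mxE ME.
  have -> : s ord_max = ord_max by apply: val_inj; rewrite /= sE /= ltnn.
  by rewrite eqxx.
have -> : u ^+ n = \prod_(i < n) u by rewrite prodr_const card_ord.
rewrite -big_split /=; apply: eq_bigr => i _; rewrite mxE mxE mxE ME.
have := ltn_ord i => lti.
have siE : s (widen_ord (leqnSn n) i) = (n.-1 - i)%N :> nat by rewrite sE /= lti.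
case: eqP => [/(congr1 (@nat_of_ord _)) /=|_]; rewrite siE; first by lia.
rewrite -Ad; [|lia ..].
by congr A; rewrite /=; lia.
Qed.
End DetTheory.

(** * The ring of formal power series *)

Definition ps_add (f g : nat -> R) (n : nat) : R := f n + g n.
Definition ps_opp (f : nat -> R) (n : nat) : R := - f n.
Definition ps_sub (f g : nat -> R) (n : nat) : R := f n - g n.
Definition ps_const (c : R) (n : nat) : R := match n with O => c | S _ => 0 end.
(** The derivation $x\,d/dx$. *)
Definition euler (f : nat -> R) (n : nat) : R := INR n * f n.

Lemma sum_f_R0_sum1 (f : nat -> R) (n : nat) : sum_f_R0 f n = f 0%nat + sum1 n f.
Proof. induction n as [|n IH]; simpl; [|rewrite IH]; ring. Qed.

Lemma sum1_ext (n : nat) (f g : nat -> R) :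
  (forall k, (1 <= k <= n)%nat -> f k = g k) -> sum1 n f = sum1 n g.
Proof.
  induction n as [|n IH]; intros H; [reflexivity|]; simpl.
  rewrite IH, H by (intros; apply H; lia) || lia; reflexivity.
Qed.

Lemma sum1_zero (n : nat) (f : nat -> R) :
  (forall k, (1 <= k <= n)%nat -> f k = 0) -> sum1 n f = 0.
Proof.
  induction n as [|n IH]; intros H; [reflexivity|]; simpl.
  rewrite IH, H by (intros; apply H; lia) || lia; ring.
Qed.

Lemma sum1_support (n m : nat) (f : nat -> R) : (m <= n)%nat ->
  (forall k, (m < k <= n)%nat -> f k = 0) -> sum1 n f = sum1 m f.
Proof.
  intros Hmn; induction Hmn as [|n Hmn IH]; intros H; [reflexivity|]; simpl.
  rewrite IH, H by (intros; apply H; lia) || lia; ring.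
Qed.

Lemma sum1_single (n k : nat) (f : nat -> R) : (1 <= k <= n)%nat ->
  (forall l, (1 <= l <= n)%nat -> l <> k -> f l = 0) -> sum1 n f = f k.
Proof.
  intros Hk H; rewrite (sum1_support n k) by (lia || intros; apply H; lia).
  destruct k as [|k]; [lia|]; simpl.
  rewrite sum1_zero by (intros; apply H; lia); ring.
Qed.

Lemma sum1_first (n : nat) (f : nat -> R) :
  sum1 (S n) f = f 1%nat + sum1 n (fun k => f (S k)).
Proof. induction n as [|n IH]; [simpl; ring|]; simpl in *; rewrite IH; ring. Qed.

Lemma sum1_scal (n : nat) (c : R) (f : nat -> R) :
  sum1 n (fun k => c * f k) = c * sum1 n f.
Proof. induction n as [|n IH]; simpl; [|rewrite IH]; ring. Qed.

Lemma sum1_rev (n : nat) (f : nat -> R) :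
  sum1 n (fun k => f (S n - k)%nat) = sum1 n f.
Proof.
  revert f; induction n as [|n IH]; intros f; [reflexivity|].
  rewrite sum1_first; change (sum1 (S n) f) with (sum1 n f + f (S n)).
  rewrite <- (IH f), Rplus_comm; reflexivity.
Qed.

Lemma conv_const (c : R) (f : nat -> R) (n : nat) : conv (ps_const c) f n = c * f n.
Proof.
  unfold conv; rewrite sum_f_R0_sum1, sum1_zero, Nat.sub_0_r; [simpl; ring|].
  intros [|k] Hk; [lia|]; simpl; ring.
Qed.

Lemma ps_ring_theory :
  ring_theory (ps_const 0) (ps_const 1) ps_add conv ps_sub ps_opp (@eq (nat -> R)).
Proof.
  constructor; intros; try (apply functional_extensionality; intros n);
    try (unfold ps_add, ps_sub, ps_opp; ring).
  - unfold ps_add; destruct n; simpl; ring.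
  - rewrite conv_const; ring.
  - now rewrite DetTheory.conv_comm.
  - now rewrite DetTheory.conv_assoc.
  - unfold conv, ps_add; rewrite <- sum_plus; apply sum_eq; intros; ring.
  - unfold ps_add, ps_opp; destruct n; simpl; ring.
Qed.

Add Ring ps_ring : ps_ring_theory.

Lemma conv_0 (f g : nat -> R) : conv f g 0 = f 0%nat * g 0%nat.
Proof. reflexivity. Qed.

(** Both end terms are split off because in a square they carry the top coefficient, which therefore
    enters linearly. *)
Lemma conv_S (f g : nat -> R) (n : nat) :
  conv f g (S n) = f 0%nat * g (S n) + sum1 n (fun k => f k * g (S n - k)%nat) + f (S n) * g 0%nat.
Proof.
  unfold conv; rewrite sum_f_R0_sum1; simpl sum1; rewrite Nat.sub_diag; simpl; ring.
Qed.

Lemma conv_S' (f g : nat -> R) (n : nat) :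
  conv f g (S n) = f 0%nat * g (S n) + sum_f_R0 (fun k => f (S k) * g (n - k)%nat) n.
Proof. unfold conv; rewrite decomp_sum by lia; reflexivity. Qed.

Lemma euler_conv (f g : nat -> R) :
  euler (conv f g) = ps_add (conv (euler f) g) (conv f (euler g)).
Proof.
  apply functional_extensionality; intros n; unfold euler, ps_add, conv.
  rewrite <- sum_plus, scal_sum; apply sum_eq; intros k Hk.
  rewrite minus_INR by exact Hk; ring.
Qed.

(** * Inverses and square roots of power series *)

Fixpoint course_upto (F : nat -> (nat -> R) -> R) (n : nat) : nat -> R :=
  match n with
  | O => fun _ => 0
  | S m => fun k => if Nat.eqb k m then F m (course_upto F m) else course_upto F m k
  end.

Definition course (F : nat -> (nat -> R) -> R) (n : nat) : R := F n (course_upto F n).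

(** Course-of-values recursion: the table [course_upto F n] is correct below [n] and 0 from [n] on,
    and the hypothesis says that [F n] reads only the correct part. *)
Lemma course_eq (F : nat -> (nat -> R) -> R) (n : nat) :
  (forall m f g, (forall k, (k < m)%nat -> f k = g k) -> F m f = F m g) ->
  course F n = F n (course F).
Proof.
  intros HF; apply HF; induction n as [|n IH]; intros k Hk; [lia|]; simpl.
  destruct (Nat.eqb_spec k n) as [->|Hkn]; [reflexivity|apply IH; lia].
Qed.

Definition ps_inv (a : nat -> R) : nat -> R :=
  course (fun n b => match n with
    | O => / a 0%nat
    | S m => - / a 0%nat * sum_f_R0 (fun k => a (S k) * b (m - k)%nat) m
    end).

Lemma ps_inv_0 (a : nat -> R) : ps_inv a 0 = / a 0%nat.
Proof. reflexivity. Qed.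

Lemma ps_inv_S (a : nat -> R) (n : nat) : ps_inv a (S n) =
  - / a 0%nat * sum_f_R0 (fun k => a (S k) * ps_inv a (n - k)%nat) n.
Proof.
  unfold ps_inv at 1; rewrite course_eq; [reflexivity|].
  intros [|m] f g H; [reflexivity|]; f_equal; apply sum_eq; intros; rewrite H by lia; reflexivity.
Qed.

Lemma conv_ps_inv (a : nat -> R) : a 0%nat <> 0 -> conv a (ps_inv a) = ps_const 1.
Proof.
  intros Ha; apply functional_extensionality; intros [|n].
  - rewrite conv_0, ps_inv_0; simpl; field; exact Ha.
  - rewrite conv_S', ps_inv_S; simpl; field; exact Ha.
Qed.

Lemma ps_inv_unique (a b : nat -> R) :
  a 0%nat <> 0 -> conv a b = ps_const 1 -> b = ps_inv a.
Proof.
  intros Ha Hab; transitivity (conv (conv a b) (ps_inv a)); [|rewrite Hab; ring].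
  transitivity (conv b (conv a (ps_inv a))); [rewrite conv_ps_inv by exact Ha|]; ring.
Qed.

Lemma ps_inv_ext (a b : nat -> R) (n : nat) :
  (forall k, (k <= n)%nat -> a k = b k) -> ps_inv a n = ps_inv b n.
Proof.
  induction n as [[|n] IH] using lt_wf_ind; intros H.
  - rewrite !ps_inv_0, H by lia; reflexivity.
  - rewrite !ps_inv_S, H by lia; f_equal; apply sum_eq; intros k Hk.
    rewrite H by lia; f_equal; apply IH; intros; try apply H; lia.
Qed.

(** The root with constant coefficient 1, a square root of [g] when [g 0 = 1]. Each later
    coefficient solves $2 b_{m+1} + \sum_{k=1}^{m} b_k b_{m+1-k} = g_{m+1}$. *)
Definition ps_sqrt (g : nat -> R) : nat -> R :=
  course (fun n b => match n with
    | O => 1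
    | S m => (g (S m) - sum1 m (fun k => b k * b (S m - k)%nat)) / 2
    end).

Lemma ps_sqrt_0 (g : nat -> R) : ps_sqrt g 0 = 1.
Proof. reflexivity. Qed.

Lemma ps_sqrt_S (g : nat -> R) (n : nat) : ps_sqrt g (S n) =
  (g (S n) - sum1 n (fun k => ps_sqrt g k * ps_sqrt g (S n - k)%nat)) / 2.
Proof.
  unfold ps_sqrt at 1; rewrite course_eq; [reflexivity|].
  intros [|m] f h H; [reflexivity|]; f_equal; f_equal; apply sum1_ext; intros.
  rewrite !H by lia; reflexivity.
Qed.

Lemma conv_ps_sqrt (g : nat -> R) : g 0%nat = 1 -> conv (ps_sqrt g) (ps_sqrt g) = g.
Proof.
  intros Hg; apply functional_extensionality; intros [|n].
  - rewrite conv_0, ps_sqrt_0, Hg; ring.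
  - rewrite conv_S, ps_sqrt_0, (ps_sqrt_S g n); field.
Qed.

(** Once the lower coefficients agree, coefficient $k$ of the square determines coefficient $k$ of
    the root through the nonzero factor $2 f_0$. *)
Lemma conv_square_inj (f g : nat -> R) (n : nat) :
  f 0%nat = g 0%nat -> f 0%nat <> 0 ->
  (forall k, (k < n)%nat -> conv f f k = conv g g k) ->
  forall k, (k < n)%nat -> f k = g k.
Proof.
  intros H0 Hf H k; induction k as [[|k] IH] using lt_wf_ind; intros Hk; [exact H0|].
  specialize (H (S k) Hk); rewrite !conv_S, <- H0 in H.
  rewrite (sum1_ext k _ (fun i => g i * g (S k - i)%nat)) in H
    by (intros; rewrite !IH by lia; reflexivity).
  apply (Rmult_eq_reg_l (f 0%nat)); [lra|exact Hf].
Qed.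

(** * Differentiating the coefficients of an inverse series *)

Lemma derivable_pt_lim_sum (F : nat -> R -> R) (D : nat -> R) (x : R) (n : nat) :
  (forall k, (k <= n)%nat -> derivable_pt_lim (F k) x (D k)) ->
  derivable_pt_lim (fun t => sum_f_R0 (fun k => F k t) n) x (sum_f_R0 D n).
Proof.
  induction n as [|n IH]; intros H; simpl; [apply H; lia|].
  apply (derivable_pt_lim_plus (fun t => sum_f_R0 (fun k => F k t) n));
    [apply IH; intros|]; apply H; lia.
Qed.

Lemma derivable_pt_lim_value (f : R -> R) (x l l' : R) :
  derivable_pt_lim f x l -> l = l' -> derivable_pt_lim f x l'.
Proof. now intros H <-. Qed.

Lemma derivable_pt_lim_affine (a v x : R) : derivable_pt_lim (fun t => a + t * v) x v.
Proof.
  intros e He; exists (mkposreal 1 Rlt_0_1); intros h Hh _.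
  replace (_ - v) with 0 by (field; exact Hh); rewrite Rabs_R0; exact He.
Qed.

(** This is $d(1/a) = -a^{-2}\,da$, coefficient by coefficient. Strong induction differentiates the
    recurrence of [ps_inv], while [D] keeps the expected derivative as a whole series, so that
    [ring] can compare the two. *)
Lemma derivable_pt_lim_ps_inv (a v : nat -> R) (n : nat) : a 0%nat <> 0 ->
  derivable_pt_lim (fun t => ps_inv (fun k => a k + t * v k) n) 0
    (- conv v (conv (ps_inv a) (ps_inv a)) n).
Proof.
  intros Ha; set (b := ps_inv a); set (D := ps_opp (conv v (conv b b))).
  change (- conv v (conv b b) n) with (D n).
  assert (H0 : a 0%nat + 0 * v 0%nat <> 0) by (now rewrite Rmult_0_l, Rplus_0_r).
  assert (HI : derivable_pt_lim (fun t => / (a 0%nat + t * v 0%nat)) 0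
                 (- v 0%nat / (a 0%nat)²)).
  { apply (derivable_pt_lim_ext (fun t => 1 / (a 0%nat + t * v 0%nat)));
      [intros; apply Rdiv_1_l|].
    eapply derivable_pt_lim_value.
    - exact (derivable_pt_lim_div _ _ _ _ _ (derivable_pt_lim_const 1 0)
        (derivable_pt_lim_affine _ _ _) H0).
    - unfold fct_cte, Rsqr; replace (a 0%nat + 0 * v 0%nat) with (a 0%nat) by ring; field; exact Ha. }
  induction n as [[|n] IH] using lt_wf_ind.
  - unfold D, ps_opp; rewrite !conv_0; unfold b; rewrite !ps_inv_0.
    eapply derivable_pt_lim_value; [exact HI|unfold Rsqr; field; exact Ha].
  - apply (derivable_pt_lim_ext
      (fun t => - / (a 0%nat + t * v 0%nat) * sum_f_R0 (fun k =>
         (a (S k) + t * v (S k)) * ps_inv (fun k => a k + t * v k) (n - k)%nat) n)).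
    { intros t; now rewrite ps_inv_S. }
    eapply derivable_pt_lim_value.
    + apply (derivable_pt_lim_mult (fun t => - / (a 0%nat + t * v 0%nat))).
      * exact (derivable_pt_lim_opp _ _ _ HI).
      * apply derivable_pt_lim_sum; intros k Hk.
        apply (derivable_pt_lim_mult (fun t => a (S k) + t * v (S k))).
        -- apply derivable_pt_lim_affine.
        -- apply IH; lia.
    + (* Comparing coefficients in a D = - v b, the derivative of a b = 1. *)
      assert (HD : conv a D (S n) = - conv v b (S n)).
      { transitivity (ps_opp (conv (conv v b) (conv a b)) (S n)).
        - apply (f_equal (fun f => f (S n))); unfold D; ring.
        - unfold b; rewrite conv_ps_inv by exact Ha.
          change (- conv v (ps_inv a) (S n)) with (ps_opp (conv v (ps_inv a)) (S n)).
          apply (f_equal (fun f => f (S n))); ring. }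
      rewrite !conv_S' in HD.
      assert (Hb : b (S n) = - / a 0%nat * sum_f_R0 (fun k => a (S k) * b (n - k)%nat) n)
        by apply ps_inv_S.
      cbv beta.
      replace (fun k => a k + 0 * v k) with a
        by (apply functional_extensionality; intros; ring).
      replace (sum_f_R0 (fun k => (a (S k) + 0 * v (S k)) * ps_inv a (n - k)%nat) n)
        with (- a 0%nat * b (S n))
        by (rewrite Hb;
            transitivity (sum_f_R0 (fun k => a (S k) * b (n - k)%nat) n);
            [field; exact Ha|apply sum_eq; intros; unfold b; ring]).
      replace (sum_f_R0 _ n) with
        (sum_f_R0 (fun k => v (S k) * b (n - k)%nat) n + sum_f_R0 (fun k => a (S k) * D (n - k)%nat) n)
        by (rewrite <- sum_plus; apply sum_eq; intros; fold b; ring).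
      rewrite Rmult_0_l, Rplus_0_r.
      apply (Rmult_eq_reg_l (a 0%nat)); [|exact Ha].
      transitivity (- (v 0%nat * b (S n) + sum_f_R0 (fun k => v (S k) * b (n - k)%nat) n)
        - sum_f_R0 (fun k => a (S k) * D (n - k)%nat) n); [unfold Rsqr; field; exact Ha|lra].
Qed.

Lemma derivable_pt_lim_ln_abs (f : R -> R) (x l : R) : f x <> 0 ->
  derivable_pt_lim f x l -> derivable_pt_lim (fun t => ln (Rabs (f t))) x (l / f x).
Proof.
  intros Hf H.
  assert (HA : derivable_pt_lim (fun t => Rabs (f t)) x (l * Rabs (f x) / f x)).
  { destruct (Rdichotomy _ _ Hf) as [Hn|Hp].
    - eapply derivable_pt_lim_value.
      + exact (derivable_pt_lim_comp f Rabs x _ _ H (Rabs_derive_2 _ Hn)).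
      + rewrite Rabs_left by exact Hn; field; exact Hf.
    - eapply derivable_pt_lim_value.
      + exact (derivable_pt_lim_comp f Rabs x _ _ H (Rabs_derive_1 _ Hp)).
      + rewrite Rabs_right by lra; field; exact Hf. }
  eapply derivable_pt_lim_value.
  - exact (derivable_pt_lim_comp _ ln x _ _ HA
      (derivable_pt_lim_ln _ (Rabs_pos_lt _ Hf))).
  - field; split; [exact Hf|now apply Rabs_no_R0].
Qed.

(** * The determinant of a sub-Hankel matrix *)

Lemma shmat_entry (r : nat) (y : nat -> R) (i j : nat) :
  (1 <= i)%nat -> (1 <= j)%nat ->
  shmat r y i j = if Nat.leb (i + j) (r + 2) then y (i + j - 1)%nat else 0.
Proof.
  intros Hi Hj; unfold shmat, Ymat; destruct (Nat.leb_spec (i + j) (r + 2)).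
  - rewrite (sum1_single (r + 1) (i + j - 1)); [|lia|].
    + destruct (Nat.eqb_spec (i + j) (i + j - 1 + 1)); [ring|lia].
    + intros l Hl Hne; destruct (Nat.eqb_spec (i + j) (l + 1)); [lia|ring].
  - apply sum1_zero; intros l Hl; destruct (Nat.eqb_spec (i + j) (l + 1)); [lia|ring].
Qed.

(** For [k > r] this reads the meaningless value [y 0]; by [ps_inv_ext] the coefficients of the
    inverse up to [r] do not see it. *)
Definition rev_coord (r : nat) (y : nat -> R) (k : nat) : R := y (r + 1 - k)%nat.

(** Entry $(i,j)$ is $y_{i+j-1} = a_{r+2-(i+j)}$ for the reversed coordinates $a$, so [det_hankel]
    applies. The sign is left unspecified because [phi] involves only $|P_1|$. *)
Lemma P1_eq (r : nat) : exists e : R, e * e = 1 /\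
  forall y : nat -> R, P2 r y <> 0 ->
    P1 r y = e * (P2 r y ^ S r * ps_inv (rev_coord r y) r).
Proof.
  destruct (DetTheory.det_hankel r) as [e He H]; exists e; split; [exact He|].
  intros y Hy; set (a := rev_coord r y).
  assert (Ha : a 0%nat = P2 r y) by (unfold a, rev_coord, P2; f_equal; lia).
  assert (Ha0 : a 0%nat <> 0) by now rewrite Ha.
  rewrite <- Ha; apply (H a (ps_inv a) (shmat r y)).
  - now rewrite conv_ps_inv.
  - intros n Hn _; rewrite conv_ps_inv by exact Ha0; destruct n; [lia|reflexivity].
  - intros i j Hi Hj Hij; rewrite shmat_entry by lia.
    destruct (Nat.leb_spec (i + j) (r + 2)); [|lia].
    unfold a, rev_coord; f_equal; lia.
  - intros i j Hi _ Hj _ Hij; rewrite shmat_entry by lia.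
    destruct (Nat.leb_spec (i + j) (r + 2)); [lia|reflexivity].
Qed.

Lemma sign_nonzero (e : R) : e * e = 1 -> e <> 0.
Proof. intros H ->; lra. Qed.

Lemma not_inSigma_iff (r : nat) (y : nat -> R) :
  ~ inSigma r y <-> P2 r y <> 0 /\ ps_inv (rev_coord r y) r <> 0.
Proof.
  destruct (P1_eq r) as [e [He H]]; apply sign_nonzero in He; unfold inSigma; split.
  - intros Hy; assert (H2 : P2 r y <> 0) by (intros E; apply Hy; rewrite E; ring).
    split; [exact H2|intros E; apply Hy; rewrite H, E by exact H2; ring].
  - intros [H2 Hb]; rewrite H by exact H2.
    repeat apply Rmult_integral_contrapositive_currified; auto; now apply pow_nonzero.
Qed.

Lemma ln_phi (r : nat) (s1 s2 : R) (y : nat -> R) : ln (phi r s1 s2 y) =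
  s1 * ln (Rabs (P1 r y)) + (s2 - (INR r - 1) * s1) * ln (Rabs (P2 r y)).
Proof.
  unfold phi, Rpower; rewrite ln_mult by apply exp_pos; now rewrite !ln_exp.
Qed.

Lemma ln_Rabs_pow (x : R) (n : nat) : x <> 0 -> ln (Rabs (x ^ n)) = INR n * ln (Rabs x).
Proof. intros Hx; rewrite <- RPow_abs; apply ln_pow; now apply Rabs_pos_lt. Qed.

Lemma ln_Rabs_mult (x y : R) :
  x <> 0 -> y <> 0 -> ln (Rabs (x * y)) = ln (Rabs x) + ln (Rabs y).
Proof. intros; rewrite Rabs_mult; apply ln_mult; now apply Rabs_pos_lt. Qed.

Lemma ln_Rabs_sign (e : R) : e * e = 1 -> ln (Rabs e) = 0.
Proof.
  intros He; assert (E : ln (Rabs (e * e)) = 0) by (rewrite He, Rabs_R1; apply ln_1).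
  rewrite ln_Rabs_mult in E by (now apply sign_nonzero); lra.
Qed.

(* The exponent (r + 1) s1 + s2 - (r - 1) s1 of P2 collapses to 2 s1 + s2. *)
Lemma ln_phi_ps_inv (r : nat) (s1 s2 : R) (y : nat -> R) : ~ inSigma r y ->
  ln (phi r s1 s2 y) =
  s1 * ln (Rabs (ps_inv (rev_coord r y) r)) + (2 * s1 + s2) * ln (Rabs (P2 r y)).
Proof.
  intros [H2 Hb]%not_inSigma_iff; destruct (P1_eq r) as [e [He H]].
  rewrite ln_phi, H by exact H2.
  assert (Hp : P2 r y ^ S r <> 0) by now apply pow_nonzero.
  rewrite !ln_Rabs_mult, ln_Rabs_pow, (ln_Rabs_sign e He), S_INR;
    try assumption; [ring|now apply sign_nonzero|].
  now apply Rmult_integral_contrapositive_currified.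
Qed.

(** * The gradient of $\log \phi_s$ *)

Definition indicator (l k : nat) : R := if Nat.eqb k l then 1 else 0.

Lemma pair_indicator (r l : nat) (z : nat -> R) : (1 <= l <= r + 1)%nat ->
  pair r (indicator l) z = z l.
Proof.
  intros Hl; unfold pair, indicator; rewrite (sum1_single _ l); [|exact Hl|].
  - rewrite Nat.eqb_refl; ring.
  - intros k Hk Hne; destruct (Nat.eqb_spec k l); [contradiction|ring].
Qed.

(** Coordinate $j+1$ of $\mathrm{Inv}_s(y)$ in terms of $b = 1/a$. Since $y_{j+1} = a_{r-j}$, the
    derivative of $b_r$ in this direction is $-(b^2)_j$. The term $\log|a_0|$ depends on $y_{r+1}$
    alone, hence the case $j = r$, and contributes $1/a_0 = b_0$. *)
Definition gradient (r : nat) (s1 s2 : R) (b : nat -> R) (j : nat) : R :=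
  - s1 * conv b b j / b r + (if Nat.eqb j r then (2 * s1 + s2) * b 0%nat else 0).

Lemma affine_nonzero_near (a v : R) : a <> 0 ->
  exists d : R, 0 < d /\ forall t, - d < t < d -> a + t * v <> 0.
Proof.
  intros Ha; assert (Hp := Rabs_pos_lt a Ha); assert (Hv := Rabs_pos v).
  (* The added 1 keeps the radius meaningful when [v = 0]. *)
  exists (Rabs a / (Rabs v + 1)).
  assert (Hd : 0 < Rabs a / (Rabs v + 1)) by (apply Rdiv_lt_0_compat; lra).
  split; [exact Hd|]; intros t Ht E.
  assert (Hat : Rabs a = Rabs t * Rabs v).
  { rewrite <- Rabs_mult, <- (Rabs_Ropp (t * v)); f_equal; lra. }
  assert (Ht' : Rabs t < Rabs a / (Rabs v + 1)) by now apply Rabs_def1.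
  apply (Rmult_lt_compat_r (Rabs v + 1)) in Ht'; [|lra].
  replace (Rabs a / (Rabs v + 1) * (Rabs v + 1)) with (Rabs a) in Ht' by (field; lra).
  assert (Htp := Rabs_pos t); nra.
Qed.

Lemma pair_sum_f_R0 (r : nat) (v z : nat -> R) :
  pair r v z = sum_f_R0 (fun j => v (S j) * z (S j)) r.
Proof.
  unfold pair; rewrite Nat.add_1_r, sum1_first, sum_f_R0_sum1; reflexivity.
Qed.

Lemma derivable_pt_lim_ln_phi (r : nat) (s1 s2 : R) (y v : nat -> R) :
  ~ inSigma r y ->
  derivable_pt_lim (fun t => ln (phi r s1 s2 (fun l => y l + t * v l))) 0
    (pair r v (fun l => gradient r s1 s2 (ps_inv (rev_coord r y)) (l - 1))).
Proof.
  intros Hy; destruct (proj1 (not_inSigma_iff r y) Hy) as [H2 Hb].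
  set (a := rev_coord r y) in *; set (b := ps_inv a) in *.
  assert (Ha : a 0%nat = P2 r y) by (unfold a, rev_coord, P2; f_equal; lia).
  assert (Hab : a 0%nat <> 0) by now rewrite Ha.
  assert (Hbi : b 0%nat = / P2 r y) by (unfold b; now rewrite ps_inv_0, Ha).
  destruct (P1_eq r) as [e [He HP]].
  destruct (affine_nonzero_near (P2 r y) (v (r + 1)%nat) H2) as [d [Hd Hnear]].
  set (yt := fun t l => y l + t * v l).
  assert (HDb := derivable_pt_lim_ps_inv a (rev_coord r v) r Hab); fold b in HDb.
  set (p := fun t => P2 r (yt t)).
  assert (Hp : derivable_pt_lim p 0 (v (r + 1)%nat)) by apply derivable_pt_lim_affine.
  set (bt := fun t => ps_inv (rev_coord r (yt t)) r).
  change (derivable_pt_lim bt 0 (- conv (rev_coord r v) (conv b b) r)) in HDb.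
  assert (Hy0 : yt 0 = y) by (apply functional_extensionality; intros; unfold yt; ring).
  assert (Hp0 : p 0 = P2 r y) by (unfold p; now rewrite Hy0).
  assert (Hb0 : bt 0 = b r) by (unfold bt; now rewrite Hy0).
  (* Up to the constant sign [e], this is $P_1$ along the line. *)
  set (q := fun t => p t ^ S r * bt t).
  assert (Hq : derivable_pt_lim q 0 (INR (S r) * p 0 ^ r * v (r + 1)%nat * bt 0
      + p 0 ^ S r * - conv (rev_coord r v) (conv b b) r)).
  { apply (derivable_pt_lim_mult (fun t => p t ^ S r)); [|exact HDb].
    exact (derivable_pt_lim_comp p (fun x => x ^ S r) 0 _ _ Hp
      (derivable_pt_lim_pow (p 0) (S r))). }
  assert (Hpw : p 0 ^ r <> 0) by (apply pow_nonzero; now rewrite Hp0).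
  assert (Hq0 : q 0 <> 0).
  { unfold q; rewrite Hp0, Hb0; apply Rmult_integral_contrapositive_currified;
      [now apply pow_nonzero|exact Hb]. }
  (* [P1_eq] requires $P_2 \ne 0$, which holds along the line only near $t = 0$. *)
  apply (derivable_pt_lim_locally_ext
    (fun t => s1 * ln (Rabs (q t)) + (s2 - (INR r - 1) * s1) * ln (Rabs (p t)))
    _ 0 (- d) d); [lra| |].
  { intros t Ht; rewrite ln_phi; fold (yt t).
    rewrite HP by (apply Hnear; exact Ht).
    change (P2 r (yt t) ^ S r * ps_inv (rev_coord r (yt t)) r) with (q t).
    fold (p t); f_equal; f_equal; rewrite Rabs_mult.
    replace (Rabs e) with 1; [now rewrite Rmult_1_l|].
    symmetry; apply ln_inv; [now apply Rabs_pos_lt, sign_nonzero|lra|].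
    rewrite ln_1; now apply ln_Rabs_sign. }
  eapply derivable_pt_lim_value.
  - apply (derivable_pt_lim_plus (fun t => s1 * ln (Rabs (q t)))).
    + apply (derivable_pt_lim_scal (fun t => ln (Rabs (q t)))), derivable_pt_lim_ln_abs;
        [exact Hq0|exact Hq].
    + apply (derivable_pt_lim_scal (fun t => ln (Rabs (p t)))), derivable_pt_lim_ln_abs;
        [now rewrite Hp0|exact Hp].
  - rewrite pair_sum_f_R0.
    (* Coefficient $r$ of $b^2$ times the reversed direction pairs $(b^2)_j$ with $v_{j+1}$. *)
    transitivity (- s1 * conv (conv b b) (rev_coord r v) r / b r
      + (2 * s1 + s2) * b 0%nat * v (r + 1)%nat).
    + rewrite (DetTheory.conv_comm (conv b b)); unfold q; rewrite Hbi.
      rewrite S_INR; simpl pow; rewrite Hb0, Hp0 in *; field; auto.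
    + unfold gradient.
      transitivity (sum_f_R0 (fun j => v (S j) * (- s1 * conv b b j / b r)) r
        + sum_f_R0 (fun j => v (S j) * (if Nat.eqb j r then (2 * s1 + s2) * b 0%nat else 0)) r).
      * f_equal.
        -- unfold conv at 1; unfold Rdiv; rewrite Rmult_assoc, (Rmult_comm _ (/ b r)), <- Rmult_assoc.
           rewrite scal_sum; apply sum_eq; intros j Hj; unfold rev_coord.
           replace (r + 1 - (r - j))%nat with (S j) by lia; ring.
        -- destruct r as [|r']; [simpl; ring|].
           rewrite tech5, Nat.eqb_refl, sum_eq_R0.
           ++ rewrite Nat.add_1_r; ring.
           ++ intros j Hj; destruct (Nat.eqb_spec j (S r')); [lia|ring].
      * rewrite <- sum_plus; apply sum_eq; intros j Hj; rewrite Nat.sub_succ, Nat.sub_0_r; ring.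
Qed.

(** Derivatives are unique, so testing against each basis vector $Y_{j+1}$ reads off the coordinates
    of $z$. *)
Lemma IsInv_iff (r : nat) (s1 s2 : R) (y z : nat -> R) : ~ inSigma r y ->
  IsInv r s1 s2 y z <->
  forall j, (j <= r)%nat -> z (S j) = gradient r s1 s2 (ps_inv (rev_coord r y)) j.
Proof.
  intros Hy; split.
  - intros H j Hj.
    assert (E := uniqueness_limite _ _ _ _ (H (indicator (S j)))
      (derivable_pt_lim_ln_phi r s1 s2 y (indicator (S j)) Hy)).
    rewrite !pair_indicator in E by lia; rewrite E; f_equal; lia.
  - intros H v; eapply derivable_pt_lim_value; [now apply derivable_pt_lim_ln_phi|].
    rewrite !pair_sum_f_R0; apply sum_eq; intros j Hj; rewrite H by exact Hj.
    now rewrite Nat.sub_succ, Nat.sub_0_r.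
Qed.

(** * The matrix of $R(z)$ and its determinant *)

Lemma mmul_shift_Ymat (r k m : nat) (X : Mat) (d : nat -> R) (p q : nat) :
  (forall i t, (1 <= i <= r)%nat -> X i t = if Nat.eqb t (i + k) then d i else 0) ->
  (forall i, (1 <= i <= r)%nat -> (i + k = r + 1)%nat -> d i = 0) ->
  (m <= r + 1)%nat -> (1 <= p <= r)%nat -> (1 <= q <= r)%nat ->
  mmul r X (Ymat m) p q = if Nat.eqb (p + q + k) (m + 1) then d p else 0.
Proof.
  intros HX Hd Hm Hp Hq; unfold mmul, Ymat.
  destruct (Nat.le_gt_cases (p + k) r) as [Hle|Hgt].
  - rewrite (sum1_single r (p + k)); [|lia|].
    + rewrite HX, Nat.eqb_refl by exact Hp.
      replace (p + k + q)%nat with (p + q + k)%nat by lia.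
      destruct (Nat.eqb (p + q + k) (m + 1)); ring.
    + intros t Ht Hne; rewrite HX by exact Hp.
      destruct (Nat.eqb_spec t (p + k)); [contradiction|ring].
  - rewrite sum1_zero.
    (* The entry of [X] in column $p + k$ now falls outside the matrix, yet the index condition can
       still hold when $p + k = r + 1$, $q = 1$ and $m = r + 1$; there $d_p = 0$. *)
    + destruct (Nat.eqb_spec (p + q + k) (m + 1)); [|reflexivity].
      symmetry; apply Hd; lia.
    + intros t Ht; rewrite HX by exact Hp; destruct (Nat.eqb_spec t (p + k)); [lia|ring].
Qed.

Lemma mmul_Ymat_tr (r m : nat) (X : Mat) (p q : nat) :
  mmul r (Ymat m) (mtr X) p q = mmul r X (Ymat m) q p.
Proof.
  apply sum1_ext; intros t _; unfold Ymat, mtr; rewrite (Nat.add_comm p t); ring.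
Qed.

(** For [X] supported on the [k]-th superdiagonal, $X Y_m + Y_m {}^tX$ has entries $d_p + d_q$ on
    one antidiagonal. When this sum is constant there, the matrix is $c\,Y_{m-k}$, or 0 if $k \ge
    m$. Both the $T_k$ and $rH_2$ are of this form. *)
Lemma mpair_shift_Ymat (r k m : nat) (X : Mat) (d : nat -> R) (c : R) (z : nat -> R) :
  (2 <= r)%nat -> (m <= r + 1)%nat ->
  (forall i t, (1 <= i <= r)%nat -> X i t = if Nat.eqb t (i + k) then d i else 0) ->
  (forall i, (1 <= i <= r)%nat -> (i + k = r + 1)%nat -> d i = 0) ->
  (forall p q, (p + q + k = m + 1)%nat -> d p + d q = c) ->
  mpair r (madd (mmul r X (Ymat m)) (mmul r (Ymat m) (mtr X))) z =
  if Nat.ltb k m then c * z (m - k)%nat else 0.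
Proof.
  intros Hr Hm HX Hd Hc; unfold mpair, pair.
  assert (HA : forall l, (1 <= l <= r + 1)%nat ->
    shcoord r (madd (mmul r X (Ymat m)) (mmul r (Ymat m) (mtr X))) l
    = if Nat.eqb (l + k) m then c else 0).
  { assert (HE : forall p q, (1 <= p <= r)%nat -> (1 <= q <= r)%nat ->
      madd (mmul r X (Ymat m)) (mmul r (Ymat m) (mtr X)) p q
      = if Nat.eqb (p + q + k) (m + 1) then c else 0).
    { intros p q Hp Hq; unfold madd; rewrite mmul_Ymat_tr.
      rewrite !(mmul_shift_Ymat r k m X d) by assumption.
      rewrite (Nat.add_comm q p); destruct (Nat.eqb_spec (p + q + k) (m + 1));
        [now apply Hc|ring]. }
    intros l Hl; unfold shcoord; destruct (Nat.leb_spec l r); rewrite HE by lia;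
      match goal with |- (if Nat.eqb ?x ?y then _ else _) = _ => destruct (Nat.eqb_spec x y) end;
      destruct (Nat.eqb_spec (l + k) m); lia || reflexivity. }
  destruct (Nat.ltb_spec k m).
  - rewrite (sum1_single _ (m - k)); [|lia|].
    + rewrite HA by lia; destruct (Nat.eqb_spec (m - k + k) m); [reflexivity|lia].
    + intros l Hl Hne; rewrite HA by lia; destruct (Nat.eqb_spec (l + k) m); [lia|ring].
  - apply sum1_zero; intros l Hl; rewrite HA by lia.
    destruct (Nat.eqb_spec (l + k) m); [lia|ring].
Qed.

(** Column $j$ comes from $T_k$ with $k = r-j$ and $d_p = r-k-p+1$; on $p+q+k = i+2$ the sum $d_p +
    d_q$ equals $2r-k-i$. *)
Lemma Rmat_entry (r : nat) (z : nat -> R) (i j : nat) :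
  (2 <= r)%nat -> (i <= r)%nat -> (1 <= j < r)%nat ->
  Rmat r z i j = if Nat.leb (r - j) i
    then (2 * INR r - INR (r - j) - INR i) * z (S (i - (r - j))) else 0.
Proof.
  intros Hr Hi Hj; unfold Rmat, gbasis; destruct (Nat.ltb_spec j r); [|lia].
  rewrite (mpair_shift_Ymat r (r - j) (S i) _
    (fun p => INR r - INR (r - j) - INR p + 1) (2 * INR r - INR (r - j) - INR i)).
  - destruct (Nat.ltb_spec (r - j) (S i)); destruct (Nat.leb_spec (r - j) i);
      try lia; [|reflexivity].
    f_equal; f_equal; lia.
  - exact Hr.
  - lia.
  - reflexivity.
  - intros p Hp E; apply (f_equal INR) in E; rewrite !plus_INR in E; simpl in E; lra.
  - intros p q E; apply (f_equal INR) in E; rewrite !plus_INR, S_INR in E; simpl in E; lra.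
Qed.

(** Here $rH_2 = \mathrm{diag}(0, \dots, r-1)$, so $k = 0$ and $d_p = p-1$. *)
Lemma Rmat_last (r : nat) (z : nat -> R) (i : nat) :
  (2 <= r)%nat -> (i <= r)%nat -> Rmat r z i r = INR i * z (S i).
Proof.
  intros Hr Hi; unfold Rmat, gbasis; rewrite Nat.ltb_irrefl.
  rewrite (mpair_shift_Ymat r 0 (S i) _ (fun p => INR p - 1) (INR i)).
  - now rewrite Nat.sub_0_r.
  - exact Hr.
  - lia.
  - intros p t Hp; unfold mscal, H2mat, Imat, Tmat; rewrite Nat.add_0_r, (Nat.eqb_sym p t).
    assert (INR r <> 0) by (apply not_0_INR; lia).
    destruct (Nat.eqb t p); simpl; field; assumption.
  - intros p Hp E; lia.
  - intros p q E; apply (f_equal INR) in E; rewrite !plus_INR, S_INR in E; simpl in E; lra.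
Qed.

(* With gamma = beta^2 and g beta = h, where h_i = r beta_i / (r - i), the Euler operator E gives
   2 r g gamma - 2 (E g) gamma - g (E gamma) = 2 ((r - E) h) beta
   = 2 r gamma - 2 r beta_r x^r + O(x^(r+1)). *)
Lemma sqrt_column_relation (r : nat) (beta : nat -> R) : beta 0%nat = 1 ->
  exists g : nat -> R, g 0%nat = 1 /\ forall i, (i <= r)%nat ->
    sum_f_R0 (fun k => g k * ((2 * INR r - INR k - INR i) * conv beta beta (i - k)%nat)) i
    = 2 * INR r * conv beta beta i - (if Nat.eqb i r then 2 * INR r * beta r else 0).
Proof.
  intros Hb0; destruct (Nat.eq_0_gt_0_cases r) as [->|Hr].
  { exists (ps_const 1); split; [reflexivity|]; intros i Hi.
    replace i with 0%nat by lia; simpl; ring. }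
  set (gamma := conv beta beta).
  (* The quotient has a pole at $i = r$. Putting $h_r = 0$ instead is what produces the defect $r
     \beta_r x^r$. *)
  set (h := fun i => if Nat.ltb i r then INR r * beta i / (INR r - INR i) else 0).
  set (g := conv h (ps_inv beta)).
  assert (Hb : beta 0%nat <> 0) by (rewrite Hb0; lra).
  assert (Hg : conv g beta = h).
  { transitivity (conv h (conv beta (ps_inv beta))); [unfold g; ring|].
    rewrite conv_ps_inv by exact Hb; ring. }
  assert (HrR : 0 < INR r) by now apply lt_0_INR.
  exists g; split.
  { assert (E := f_equal (fun f => f 0%nat) Hg); cbv beta in E.
    rewrite conv_0, Hb0 in E; unfold h in E.
    destruct (Nat.ltb_spec 0 r); [|lia]; rewrite Hb0 in E; simpl INR in E.
    rewrite Rmult_1_r in E; rewrite E; field; lra. }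
  intros i Hi; set (c := ps_const (INR r)).
  set (E1 := ps_sub (conv (ps_const 2) (conv c (conv g gamma)))
    (ps_add (conv (ps_const 2) (conv (euler g) gamma)) (conv g (euler gamma)))).
  set (E2 := conv (ps_const 2) (conv (ps_sub (conv c h) (euler h)) beta)).
  assert (HE : E1 = E2).
  { unfold E1, E2; rewrite <- Hg, euler_conv; unfold gamma; rewrite euler_conv.
    assert (H2 : ps_const 2 = ps_add (ps_const 1) (ps_const 1))
      by (apply functional_extensionality; intros [|n]; unfold ps_add; simpl; ring).
    rewrite H2; ring. }
  (* The weights combine as $2r - 2k - (i-k) = 2r - k - i$. *)
  transitivity (E1 i).
  { unfold E1, c, ps_sub, ps_add; rewrite !conv_const; unfold conv.
    rewrite !scal_sum, <- plus_sum, <- minus_sum; apply sum_eq; intros k Hk.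
    unfold euler; rewrite minus_INR by exact Hk; ring. }
  rewrite HE; unfold E2; rewrite conv_const; unfold conv at 1.
  assert (Hh : forall k, (k <= r)%nat -> ps_sub (conv c h) (euler h) k
    = INR r * beta k - (if Nat.eqb k r then INR r * beta r else 0)).
  { intros k Hk; unfold ps_sub, c, euler; rewrite conv_const; unfold h.
    destruct (Nat.ltb_spec k r) as [Hlt|Hge]; destruct (Nat.eqb_spec k r); try lia.
    - assert (INR k < INR r) by now apply lt_INR.
      field; lra.
    - subst k; ring. }
  transitivity (2 * (INR r * gamma i - (if Nat.eqb i r then INR r * beta r else 0)));
    [|destruct (Nat.eqb i r); ring].
  f_equal; unfold gamma, conv; rewrite scal_sum.
  destruct i as [|i].
  { cbn [sum_f_R0]; rewrite Hh by lia; destruct (Nat.eqb_spec 0 r); [lia|ring]. }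
  rewrite !tech5, Nat.sub_diag, Hh, Hb0 by exact Hi.
  rewrite (sum_eq _ (fun k => beta k * beta (S i - k)%nat * INR r)).
  - ring.
  - intros k Hk; rewrite Hh by lia; destruct (Nat.eqb_spec k r); [lia|ring].
Qed.

(** With $\gamma = \beta^2$ the normalized coordinates of $z$, [sqrt_column_relation] says that
    subtracting $g_k$ times the column of $T_k$, for $0 < k < r$, from the column of $rH_2$ leaves
    only the last entry $2 r z_1 \beta_r$. Then [det_hessenberg] applies with $u = 2 z_1$. *)
Lemma Q1_eq (r : nat) : (2 <= r)%nat -> exists K : R, K <> 0 /\
  forall z : nat -> R, Q2 z <> 0 ->
    Q1 r z = K * (Q2 z ^ r * ps_sqrt (fun j => z (S j) / Q2 z) r).
Proof.
  intros Hr; destruct r as [|n]; [lia|].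
  destruct (DetTheory.det_hessenberg n) as [K HK H].
  (* The normalization of $Q_1$, then [K], the factor $2^n$ of $(2z_1)^n$ and the factor $2r$ of the
     last entry. *)
  exists ((-1) ^ (S n + 1) * 2 ^ l2 (S n) / INR (fact (S n)) * (K * (2 ^ n * (2 * INR (S n))))).
  split.
  { repeat apply Rmult_integral_contrapositive_currified; try apply Rinv_neq_0_compat;
      try apply pow_nonzero; try exact HK; try apply INR_fact_neq_0; try lra.
    apply not_0_INR; lia. }
  intros z Hz; set (gamma := fun j => z (S j) / Q2 z); set (beta := ps_sqrt gamma).
  assert (Hg : conv beta beta = gamma)
    by (apply conv_ps_sqrt; unfold gamma, Q2 in *; field; exact Hz).
  destruct (sqrt_column_relation (S n) beta (ps_sqrt_0 _)) as [g [Hg0 HgE]].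
  rewrite Hg in HgE.
  assert (Hcol : forall i, (1 <= i <= S n)%nat ->
    sum1 n (fun j => Rmat (S n) z i j * - g (S n - j)%nat) + Rmat (S n) z i (S n)
    = if Nat.eqb i (S n) then 2 * INR (S n) * Q2 z * beta (S n) else 0).
  { intros i Hi; rewrite Rmat_last by lia.
    set (F := fun k => if Nat.leb k i
      then Q2 z * (g k * ((2 * INR (S n) - INR k - INR i) * gamma (i - k)%nat)) else 0).
    assert (HF : sum1 n (fun j => Rmat (S n) z i j * - g (S n - j)%nat) = - sum1 n F).
    { transitivity (sum1 n (fun j => -1 * F (S n - j)%nat)).
      - apply sum1_ext; intros j Hj; rewrite Rmat_entry by lia; unfold F, gamma.
        destruct (Nat.leb (S n - j) i); [field; exact Hz|ring].
      - rewrite sum1_scal, (sum1_rev n F); ring. }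
    assert (HFn : sum1 n F = sum1 i F).
    { rewrite <- (sum1_support (S n) i).
      (* The relation has a term $k = r$ but there is no column for $T_r$. That term occurs only for
         $i = r$, where its weight $2r-k-i$ vanishes. *)
      - simpl; assert (HF0 : F (S n) = 0); [|rewrite HF0; ring].
        unfold F; destruct (Nat.leb_spec (S n) i); [|reflexivity].
        replace i with (S n) by lia; ring.
      - lia.
      - intros k Hk; unfold F; destruct (Nat.leb_spec k i); [lia|reflexivity]. }
    assert (HS := HgE i ltac:(lia)).
    rewrite sum_f_R0_sum1, Nat.sub_0_r, Hg0 in HS.
    assert (HF' : sum1 i F = Q2 z * sum1 i (fun k =>
      g k * ((2 * INR (S n) - INR k - INR i) * gamma (i - k)%nat))).
    { transitivity (sum1 i (fun k =>
        Q2 z * (g k * ((2 * INR (S n) - INR k - INR i) * gamma (i - k)%nat)))).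
      - apply sum1_ext; intros k Hk; unfold F.
        destruct (Nat.leb_spec k i); [reflexivity|lia].
      - apply sum1_scal. }
    assert (Hzi : z (S i) = Q2 z * gamma i) by (unfold gamma; field; exact Hz).
    (* The term $k = 0$ of the relation is $(2r-i)\gamma_i$; moved to the other side it leaves
       $i\gamma_i$, which cancels the entry of the last column. *)
    rewrite HF, HFn, HF', Hzi.
    change (INR 0) with 0 in HS.
    destruct (Nat.eqb i (S n)).
    - match type of HS with _ + ?s = _ => replace s with
        (2 * INR (S n) * gamma i - 2 * INR (S n) * beta (S n)
         - 1 * ((2 * INR (S n) - 0 - INR i) * gamma i)) by lra end; ring.
    - match type of HS with _ + ?s = _ => replace s with
        (2 * INR (S n) * gamma i - 0
         - 1 * ((2 * INR (S n) - 0 - INR i) * gamma i)) by lra end; ring. }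
  assert (HD : det (S n) (Rmat (S n) z)
    = K * ((2 * Q2 z) ^ n * (2 * INR (S n) * Q2 z * beta (S n)))).
  { apply (H _ _ (fun j => - g (S n - j)%nat)).
    - intros i j Hi Hj Hij; rewrite Rmat_entry by lia.
      destruct (Nat.leb_spec (S n - j) i); [lia|reflexivity].
    - intros j Hj Hjn; change (Rmat (S n) z (S n - j)%nat j = INR j * (2 * Q2 z)).
      rewrite Rmat_entry by lia.
      destruct (Nat.leb_spec (S n - j) (S n - j)); [|lia].
      rewrite Nat.sub_diag, minus_INR by lia.
      change (z 1%nat) with (Q2 z); ring.
    - intros i Hi Hin; rewrite Hcol by lia; destruct (Nat.eqb_spec i (S n)); [lia|reflexivity].
    - rewrite Hcol by lia; now rewrite Nat.eqb_refl. }
  unfold Q1; rewrite HD, Rpow_mult_distr; simpl (Q2 z ^ S n); ring.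
Qed.

(** * Solving the gradient equations for $b$ *)

Lemma conv_scal_square (c : R) (f : nat -> R) (n : nat) :
  conv (fun k => c * f k) (fun k => c * f k) n = c * c * conv f f n.
Proof. unfold conv; rewrite scal_sum; apply sum_eq; intros; ring. Qed.

Lemma conv_ext (f f' g g' : nat -> R) (n : nat) :
  (forall k, (k <= n)%nat -> f k = f' k) -> (forall k, (k <= n)%nat -> g k = g' k) ->
  conv f g n = conv f' g' n.
Proof. intros Hf Hg; apply sum_eq; intros; rewrite Hf, Hg by lia; reflexivity. Qed.

Lemma gradient_lt (r : nat) (s1 s2 : R) (b : nat -> R) (j : nat) : (j < r)%nat ->
  gradient r s1 s2 b j = - s1 * conv b b j / b r.
Proof. intros Hj; unfold gradient; destruct (Nat.eqb_spec j r); [lia|ring]. Qed.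

(** The end terms of $(b^2)_r$ are $2 b_0 b_r$; they contribute $-2 s_1 b_0$, which cancels against
    $(2 s_1 + s_2) b_0$. *)
Lemma gradient_last (n : nat) (s1 s2 : R) (b beta : nat -> R) :
  b (S n) <> 0 -> beta 0%nat = 1 ->
  (forall k, (k < S n)%nat -> b k = b 0%nat * beta k) ->
  gradient (S n) s1 s2 b (S n) =
  s2 * b 0%nat + (- s1 * (b 0%nat * b 0%nat) / b (S n)) * (conv beta beta (S n) - 2 * beta (S n)).
Proof.
  intros Hb Hbeta H; unfold gradient; rewrite Nat.eqb_refl, !conv_S, Hbeta.
  rewrite (sum1_ext n _ (fun k => (b 0%nat * b 0%nat) * (beta k * beta (S n - k)%nat))).
  - rewrite sum1_scal; field; exact Hb.
  - intros k Hk; rewrite (H k), (H (S n - k)%nat) by lia; ring.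
Qed.

(** The equation $j = 0$ gives $b_r$. Those with $j < r$ say $b^2 = b_0^2 \gamma$ below degree $r$,
    hence $b = b_0 \beta$ there. In the last one $z_1 \gamma_r$ cancels by [gradient_last], leaving
    $s_2 b_0 = 2 z_1 \beta_r$. *)
Lemma gradient_iff (r : nat) (s1 s2 : R) (b z : nat -> R) :
  (1 <= r)%nat -> s1 <> 0 -> s2 <> 0 -> Q2 z <> 0 -> b 0%nat <> 0 -> b r <> 0 ->
  let beta := ps_sqrt (fun j => z (S j) / Q2 z) in
  (forall j, (j <= r)%nat -> z (S j) = gradient r s1 s2 b j) <->
  b 0%nat = 2 * Q2 z * beta r / s2 /\
  (forall k, (k < r)%nat -> b k = b 0%nat * beta k) /\
  b r = - s1 * (b 0%nat * b 0%nat) / Q2 z.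
Proof.
  intros Hr Hs1 Hs2 Hz Hb0 Hbr beta; destruct r as [|n]; [lia|].
  set (gamma := fun j => z (S j) / Q2 z) in *.
  assert (Hg : conv beta beta = gamma)
    by (apply conv_ps_sqrt; unfold gamma, Q2 in *; field; exact Hz).
  assert (Hzg : forall j, z (S j) = Q2 z * gamma j)
    by (intros j; unfold gamma; field; exact Hz).
  assert (Hbb : b 0%nat * b 0%nat <> 0) by now apply Rmult_integral_contrapositive_currified.
  split.
  - intros H.
    assert (H0 := H 0%nat ltac:(lia)); rewrite gradient_lt, conv_0 in H0 by lia.
    fold (Q2 z) in H0.
    assert (Hlast : b (S n) = - s1 * (b 0%nat * b 0%nat) / Q2 z)
      by (rewrite H0; field; auto).
    assert (Hlow : forall k, (k < S n)%nat -> b k = b 0%nat * beta k).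
    { apply (conv_square_inj b (fun k => b 0%nat * beta k)).
      - unfold beta; rewrite ps_sqrt_0; ring.
      - exact Hb0.
      - intros k Hk; rewrite conv_scal_square, Hg.
        specialize (H k ltac:(lia)); rewrite gradient_lt, Hzg, H0 in H by exact Hk.
        apply (Rmult_eq_reg_l (- s1 / b (S n))).
        + transitivity (- s1 * conv b b k / b (S n)); [field; exact Hbr|].
          rewrite <- H; field; exact Hbr.
        + apply Rmult_integral_contrapositive_currified;
            [lra|now apply Rinv_neq_0_compat]. }
    split; [|split; [exact Hlow|exact Hlast]].
    specialize (H (S n) (le_n _)).
    rewrite (gradient_last n s1 s2 b beta Hbr (ps_sqrt_0 _) Hlow), Hg, <- H0, Hzg in H.
    apply (Rmult_eq_reg_l s2); [|exact Hs2].
    replace (s2 * b 0%nat) with (2 * Q2 z * beta (S n)) by lra; field; exact Hs2.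
  - intros [Hb [Hlow Hlast]] j Hj.
    assert (H0 : Q2 z = - s1 * (b 0%nat * b 0%nat) / b (S n))
      by (rewrite Hlast; field; auto).
    destruct (Nat.eq_dec j (S n)) as [->|Hne].
    + rewrite (gradient_last n s1 s2 b beta Hbr (ps_sqrt_0 _) Hlow), Hg, <- H0, Hzg.
      replace (s2 * b 0%nat) with (2 * Q2 z * beta (S n)) by (rewrite Hb; field; exact Hs2).
      ring.
    + rewrite gradient_lt, Hzg by lia.
      rewrite (conv_ext _ (fun k => b 0%nat * beta k) _ (fun k => b 0%nat * beta k))
        by (intros; apply Hlow; lia).
      rewrite conv_scal_square, Hg.
      transitivity (- s1 * (b 0%nat * b 0%nat) / b (S n) * gamma j); [now rewrite <- H0|].
      field; exact Hbr.
Qed.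

(** * The preimage under $\mathrm{Inv}_s$ and the value of the transform *)

Theorem theorem1 (r : nat) (hr : (2 <= r)%nat) (s1 s2 : R)
  (hs1 : s1 <> 0) (hs2 : s2 <> 0) (e1 e2 : R)
  (he1 : e1 = 1 \/ e1 = -1) (he2 : e2 = 1 \/ e2 = -1) :
  exists c : R, 0 < c /\
    forall z : nat -> R, 0 < e1 * Q1 r z -> 0 < e2 * Q2 z ->
      exists y : nat -> R,
        ~ inSigma r y /\ IsInv r s1 s2 y z /\
        (forall y' : nat -> R, ~ inSigma r y' -> IsInv r s1 s2 y' z ->
           forall l : nat, (1 <= l <= r + 1)%nat -> y' l = y l) /\
        / phi r s1 s2 y = c * psi r s1 s2 z.
Proof.
  destruct (Q1_eq r hr) as [K [HK HQ]].
  (* This is $|s_1|^{-s_1} (2/|s_2 K|)^{s_2}$, what remains of $1/\phi_s(y)$ after dividing by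
     $\psi_s(z)$. *)
  exists (exp (- s1 * ln (Rabs s1) + s2 * (ln (Rabs 2) - ln (Rabs s2) - ln (Rabs K)))).
  split; [apply exp_pos|]; intros z Hz1 Hz2.
  assert (HQ2 : Q2 z <> 0) by (intros E; rewrite E in Hz2; lra).
  assert (HQ1 : Q1 r z <> 0) by (intros E; rewrite E in Hz1; lra).
  set (beta := ps_sqrt (fun j => z (S j) / Q2 z)).
  specialize (HQ z HQ2); fold beta in HQ.
  assert (Hbeta : beta r <> 0) by (intros E; apply HQ1; rewrite HQ, E; ring).
  assert (Hpow : Q2 z ^ r <> 0) by now apply pow_nonzero.
  set (b0 := 2 * Q2 z * beta r / s2).
  set (br := - s1 * (b0 * b0) / Q2 z).
  assert (Hb0 : b0 <> 0).
  { unfold b0, Rdiv; repeat apply Rmult_integral_contrapositive_currified; auto;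
      try lra; now apply Rinv_neq_0_compat. }
  assert (Hbr : br <> 0).
  { unfold br, Rdiv; repeat apply Rmult_integral_contrapositive_currified; auto;
      try lra; now apply Rinv_neq_0_compat. }
  (* The solution of [gradient_iff], continued by an arbitrary value beyond degree $r$. *)
  set (b := fun k => if Nat.ltb k r then b0 * beta k else br).
  assert (Hbb0 : b 0%nat = b0).
  { unfold b; destruct (Nat.ltb_spec 0 r); [|lia]; unfold beta; rewrite ps_sqrt_0; ring. }
  assert (Hbbr : b r = br) by (unfold b; now rewrite Nat.ltb_irrefl).
  assert (Hb0' : b 0%nat <> 0) by now rewrite Hbb0.
  set (a := ps_inv b).
  assert (Ha0 : a 0%nat <> 0) by (unfold a; rewrite ps_inv_0; now apply Rinv_neq_0_compat).
  assert (Hinva : ps_inv a = b).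
  { symmetry; apply ps_inv_unique; [exact Ha0|].
    rewrite DetTheory.conv_comm; now apply conv_ps_inv. }
  set (y := fun l => a (r + 1 - l)%nat).
  assert (Hya : forall k, (k <= r)%nat -> ps_inv (rev_coord r y) k = b k).
  { intros k Hk; rewrite <- Hinva; apply ps_inv_ext; intros m Hm.
    unfold rev_coord, y; f_equal; lia. }
  assert (HP2 : P2 r y = / b0).
  { unfold P2, y; rewrite Nat.sub_diag; unfold a; now rewrite ps_inv_0, Hbb0. }
  assert (Hy : ~ inSigma r y).
  { apply not_inSigma_iff; split; [rewrite HP2; now apply Rinv_neq_0_compat|].
    rewrite Hya, Hbbr by lia; exact Hbr. }
  (* This yields both existence and uniqueness of the preimage. *)
  assert (Hcase : forall y', ~ inSigma r y' ->
    IsInv r s1 s2 y' z <-> forall k, (k <= r)%nat -> ps_inv (rev_coord r y') k = b k).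
  { intros y' Hy'; rewrite IsInv_iff by exact Hy'.
    apply not_inSigma_iff in Hy'; destruct Hy' as [Hp Hi].
    assert (Hp0 : ps_inv (rev_coord r y') 0 <> 0).
    { rewrite ps_inv_0; apply Rinv_neq_0_compat; unfold rev_coord; now rewrite Nat.sub_0_r. }
    rewrite gradient_iff by (assumption || lia); fold beta; fold b0; split.
    - intros [E0 [Elow Er]] k Hk; unfold b; destruct (Nat.ltb_spec k r).
      + now rewrite Elow, E0.
      + replace k with r by lia; now rewrite Er, E0.
    - intros E; rewrite !E, Hbb0 by lia; split; [reflexivity|split].
      + intros k Hk; rewrite E by lia; unfold b; destruct (Nat.ltb_spec k r); [reflexivity|lia].
      + exact Hbbr. }
  exists y; split; [exact Hy|split; [now apply Hcase|split]].
  - intros y' Hy' Hinv l Hl; rewrite Hcase in Hinv by exact Hy'.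
    apply not_inSigma_iff in Hy'; destruct Hy' as [Hp _].
    set (a' := rev_coord r y') in *.
    assert (Ha' : a' 0%nat <> 0) by (unfold a', rev_coord; now rewrite Nat.sub_0_r).
    (* Inverting twice turns agreement of the inverses up to degree $r$ into agreement of the
       coordinates. *)
    assert (Ea' : a' = ps_inv (ps_inv a')).
    { apply ps_inv_unique; [rewrite ps_inv_0; now apply Rinv_neq_0_compat|].
      rewrite DetTheory.conv_comm; now apply conv_ps_inv. }
    transitivity (a' (r + 1 - l)%nat); [unfold a', rev_coord; f_equal; lia|].
    rewrite Ea'; apply ps_inv_ext; intros k Hk; apply Hinv; lia.
  - assert (Hphi : 0 < phi r s1 s2 y)
      by (unfold phi, Rpower; apply Rmult_lt_0_compat; apply exp_pos).
    (* Both sides are positive, so comparing logarithms suffices and makes the identity linear. *)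
    apply ln_inv.
    + now apply Rinv_0_lt_compat.
    + unfold psi, Rpower; repeat apply Rmult_lt_0_compat; apply exp_pos.
    + unfold psi, Rpower; rewrite ln_Rinv by exact Hphi.
      rewrite ln_phi_ps_inv, Hya, Hbbr, HP2 by (exact Hy || lia).
      rewrite <- !exp_plus, ln_exp, HQ.
      rewrite !ln_Rabs_mult, ln_Rabs_pow by auto.
      assert (Hinv : forall x, x <> 0 -> ln (Rabs (/ x)) = - ln (Rabs x)).
      { intros x Hx; rewrite Rabs_inv; apply ln_Rinv; now apply Rabs_pos_lt. }
      assert (Hlb0 : ln (Rabs b0) = ln (Rabs 2) + ln (Rabs (Q2 z)) + ln (Rabs (beta r)) - ln (Rabs s2)).
      { unfold b0, Rdiv; rewrite !ln_Rabs_mult, Hinv by auto with real; ring. }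
      assert (Hlbr : ln (Rabs br) = ln (Rabs s1) + 2 * ln (Rabs b0) - ln (Rabs (Q2 z))).
      { unfold br, Rdiv; rewrite !ln_Rabs_mult, Hinv, Rabs_Ropp by auto with real; ring. }
      rewrite Hinv by exact Hb0; rewrite Hlbr, Hlb0; ring.
Qed.
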